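(* There is a polynomial-time algorithm for the special case of SMC-1 in which each man finds at most two women acceptable; that is, given such an instance, it computes a feasible matching with the minimum number of blocking pairs, or reports that no feasible matching exists.
   Context: An instance of Stable Marriage with Covering Constraints (SMC) consists of a finite set $\mathcal M$ of men, a finite set $\mathcal W$ of women, for each person $x$ a preference list $L(x)$ strictly ordering a subset of the opposite sex (the persons acceptable to $x$), and subsets $\mathcal W^\star\subseteq\mathcal W$, $\mathcal M^\star\subseteq\mathcal M$ of distinguished persons. A matching is a set of disjoint man–woman pairs $\{m,w\}$ with $m$ and $w$ in each other's lists; $M(x)$ denotes the partner of $x$. A pair $\{m,w\}$ of mutually acceptable persons is blocking for $M$ if $m$ is unmatched or prefers $w$ to $M(m)$, and $w$ is unmatched or prefers $m$ to $M(w)$. A matching is feasible if it matches every person in $\mathcal W^\star\cup\mathcal M^\star$. SMC-1 is the special case $\mathcal M^\star=\emptyset$. *)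

(* Defs.v *)
From mathcomp Require Import all_boot.

Set Implicit Arguments.
Unset Strict Implicit.
Unset Printing Implicit Defensive.

(* The machine model is the WHILE language on binary trees of N. D. Jones,
   "Computability and Complexity from a Programming Perspective" (MIT Press,
   1997), without its equality test: every elementary operation costs one time
   unit. Trees are immutable and can be shared through pointers, so [ECons] does
   run in constant time and WHILE programs and Turing machines simulate each
   other with polynomial overhead. *)

Inductive tree : Type :=
| Nil : tree
| Cons : tree -> tree -> tree.

Definition thd (d : tree) : tree := if d is Cons a _ then a else Nil.
Definition ttl (d : tree) : tree := if d is Cons _ b then b else Nil.

Fixpoint tsize (d : tree) : nat :=
  if d is Cons a b then (tsize a + tsize b).+1 else 1.

Inductive expr : Type :=
| EVar : nat -> expr
| ENil : expr
| ECons : expr -> expr -> expr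
| EHd : expr -> expr
| ETl : expr -> expr.

Inductive cmd : Type :=
| CSkip : cmd
| CAssign : nat -> expr -> cmd
| CSeq : cmd -> cmd -> cmd
| CIf : expr -> cmd -> cmd -> cmd
| CWhile : expr -> cmd -> cmd.

Definition store : Type := nat -> tree.

Definition update (s : store) (x : nat) (d : tree) : store :=
  fun y => if y == x then d else s y.

Fixpoint eval (e : expr) (s : store) : tree :=
  match e with
  | EVar x => s x
  | ENil => Nil
  | ECons e1 e2 => Cons (eval e1 s) (eval e2 s)
  | EHd e1 => thd (eval e1 s)
  | ETl e1 => ttl (eval e1 s)
  end.

Fixpoint ecost (e : expr) : nat :=
  match e with
  | EVar _ => 1
  | ENil => 1
  | ECons e1 e2 => (ecost e1 + ecost e2).+1
  | EHd e1 => (ecost e1).+1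
  | ETl e1 => (ecost e1).+1
  end.

(* [exec c s t s']: from store [s], the command [c] halts after [t] time units
   in store [s']. In tests, [Nil] is false and all other trees are true. *)
Inductive exec : cmd -> store -> nat -> store -> Prop :=
| exec_skip s :
    exec CSkip s 1 s
| exec_assign x e s :
    exec (CAssign x e) s (ecost e).+1 (update s x (eval e s))
| exec_seq c1 c2 s s1 s2 t1 t2 :
    exec c1 s t1 s1 -> exec c2 s1 t2 s2 ->
    exec (CSeq c1 c2) s (t1 + t2) s2
| exec_if_true e c1 c2 s s1 t :
    eval e s <> Nil -> exec c1 s t s1 ->
    exec (CIf e c1 c2) s ((ecost e).+1 + t) s1
| exec_if_false e c1 c2 s s1 t :
    eval e s = Nil -> exec c2 s t s1 ->
    exec (CIf e c1 c2) s ((ecost e).+1 + t) s1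
| exec_while_true e c s s1 s2 t1 t2 :
    eval e s <> Nil -> exec c s t1 s1 -> exec (CWhile e c) s1 t2 s2 ->
    exec (CWhile e c) s ((ecost e).+1 + t1 + t2) s2
| exec_while_false e c s :
    eval e s = Nil ->
    exec (CWhile e c) s (ecost e).+1 s.

(* A program reads its input from variable 0 and leaves its output there. *)
Definition runs_in (p : cmd) (d : tree) (t : nat) (d' : tree) : Prop :=
  exists2 s, exec p (update (fun=> Nil) 0 d) t s & s 0 = d'.

(* [dom] is the promise on the inputs, [enc] their encoding, and [spec x d]
   says that the tree [d] is a correct answer on input [x]. *)
Definition poly_time_solvable (X : Type) (dom : X -> Prop) (enc : X -> tree)
    (spec : X -> tree -> Prop) : Prop :=
  exists (p : cmd) (c k : nat), forall x : X, dom x ->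
    exists (t : nat) (d : tree),
      [/\ runs_in p (enc x) t d,
          t <= c * tsize (enc x) ^ k + c
        & spec x d].

Record smc : Type := SMC {
  nmen : nat;
  nwomen : nat;
  (* Preference lists, most preferred first. *)
  mlist : 'I_nmen -> seq 'I_nwomen;
  wlist : 'I_nwomen -> seq 'I_nmen;
  mstar : {set 'I_nmen};
  wstar : {set 'I_nwomen};
  mlist_uniq : forall m, uniq (mlist m);
  wlist_uniq : forall w, uniq (wlist w)
}.

Notation man I := 'I_(nmen I).
Notation woman I := 'I_(nwomen I).

Section Matchings.

Variable I : smc.
Implicit Types (S : {set man I * woman I}) (m : man I) (w : woman I).

Definition acceptable m w : bool := (w \in mlist m) && (m \in wlist w).

Definition matching S : Prop :=
  (forall p, p \in S -> acceptable p.1 p.2) /\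
  (forall p q, p \in S -> q \in S -> p != q -> (p.1 != q.1) && (p.2 != q.2)).

Definition mpartner S m : option (woman I) := [pick w | (m, w) \in S].
Definition wpartner S w : option (man I) := [pick m | (m, w) \in S].

Definition mprefers m w w' : bool := index w (mlist m) < index w' (mlist m).
Definition wprefers w m m' : bool := index m (wlist w) < index m' (wlist w).

Definition blocking S m w : bool :=
  [&& acceptable m w,
      if mpartner S m is Some w' then mprefers m w w' else true
    & if wpartner S w is Some m' then wprefers w m m' else true].

Definition num_blocking S : nat := #|[set p | blocking S p.1 p.2]|.

Definition feasible S : Prop :=
  (forall w, w \in wstar I -> wpartner S w <> None) /\
  (forall m, m \in mstar I -> mpartner S m <> None).

Definition optimal S : Prop :=
  [/\ matching S, feasible S
    & forall S', matching S' -> feasible S' ->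
        num_blocking S <= num_blocking S'].

End Matchings.

Definition smc1 (I : smc) : Prop := mstar I = set0.

(* Numbers only occur as indices of persons, so writing them in unary changes
   the length of the input at most polynomially. *)
Definition enc_nat (n : nat) : tree := iter n (Cons Nil) Nil.

Definition enc_seq (T : Type) (f : T -> tree) (s : seq T) : tree :=
  foldr (fun x => Cons (f x)) Nil s.

Definition enc_ord (n : nat) (i : 'I_n) : tree := enc_nat i.

(* The numbers of men and of women are the lengths of the first two lists. *)
Definition enc_smc (I : smc) : tree :=
  Cons (enc_seq (fun m => enc_seq (@enc_ord _) (mlist m)) (enum (man I)))
  (Cons (enc_seq (fun w => enc_seq (@enc_ord _) (wlist w)) (enum (woman I)))
  (Cons (enc_seq (@enc_ord _) (enum (mstar I)))
        (enc_seq (@enc_ord _) (enum (wstar I))))).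

Definition enc_pairs (I : smc) (s : seq (man I * woman I)) : tree :=
  enc_seq (fun p => Cons (enc_ord p.1) (enc_ord p.2)) s.

(* The answer is [Nil] for "no feasible matching", or [Cons Nil _] carrying the
   pairs of an optimal matching, listed in any order without repetition. *)
Definition smc_answer (I : smc) (d : tree) : Prop :=
  (d = Nil /\ ~ exists S : {set man I * woman I}, matching S /\ feasible S) \/
  (exists s : seq (man I * woman I),
     [/\ d = Cons Nil (enc_pairs s), uniq s & optimal [set p in s]]).

(* Main.v *)
(** Call [m] a first-choice man of [w] if [w] is his favourite among the women
    who accept him. In any matching, a first-choice man of [w] whom [w] strictly
    prefers to her partner blocks with [w]. If men have at most two women, every
    other blocking pair [(m, w)] has [m] unmatched, and handing [m] over to [w]
    makes no new first-choice pair block. Hence minimising the number of blocking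
    pairs means maximising [sum_w #{first-choice men of w not preferred to M(w)}],
    and this objective, having one term per matched pair, is a maximum-weight
    bipartite matching problem. Two further digits of the weights force the
    distinguished women to be matched and exclude the blocking pairs of unmatched
    men.

    The matching is found by an auction: an unmatched woman takes the man of
    largest (weight - price) and raises his price by one. Prices are bounded by the
    weights, which are polynomial in the input, and by LP duality the final
    matching is optimal up to one unit per pair. *)

From mathcomp Require Import all_boot zify.
Require Import Defs.

Set Implicit Arguments.
Unset Strict Implicit.
Unset Printing Implicit Defensive.

(** * Polynomial-time functions *)

(** Bounds are kept as functions built from sums and products over the naturals: they are closed
    under composition and monotone, both by induction on the construction. The form [c * n ^ k + c]
    is only recovered at the end. *)
Inductive polynomial : (nat -> nat) -> Prop :=
| poly_id : polynomial (fun n => n)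
| poly_const c : polynomial (fun=> c)
| poly_add f g : polynomial f -> polynomial g -> polynomial (fun n => f n + g n)
| poly_mul f g : polynomial f -> polynomial g -> polynomial (fun n => f n * g n).

Lemma poly_comp f g :
  polynomial f -> polynomial g -> polynomial (fun n => f (g n)).
Proof.
move=> Pf Pg; elim: Pf => [//|c|f1 f2 _ P1 _ P2|f1 f2 _ P1 _ P2].
- exact: poly_const.
- exact: poly_add P1 P2.
- exact: poly_mul P1 P2.
Qed.

Lemma poly_homo f : polynomial f -> {homo f : m n / m <= n}.
Proof.
elim=> [//|c|f1 f2 _ h1 _ h2|f1 f2 _ h1 _ h2] m n le_mn //.
- exact: leq_add (h1 _ _ le_mn) (h2 _ _ le_mn).
- exact: leq_mul (h1 _ _ le_mn) (h2 _ _ le_mn).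
Qed.

Lemma poly_bound f :
  polynomial f -> exists c k, forall n, f n <= c * n ^ k + c.
Proof.
(* With base [n.+1], which is never zero, powers grow with the exponent, so sums and products of
   bounds combine. Going back to base [n] costs a factor [2 ^ k], since [n.+2 <= 2 * n.+1]. *)
move=> Pf; suff [c [k le_f]] : exists c k, forall n, f n <= c * n.+1 ^ k.
  exists (c * 2 ^ k), k => -[|n]; apply: leq_trans (le_f _) _.
    by rewrite exp1n muln1 -{1}[c]muln1 (leq_trans _ (leq_addl _ _))
               // leq_mul // expn_gt0.
  rewrite -mulnA -expnMn (leq_trans _ (leq_addr _ _)) // leq_mul //.
  by case: k {le_f} => // k; rewrite leq_exp2r //; lia.
elim: Pf => [|c|f1 f2 _ [c1 [k1 le1]] _ [c2 [k2 le2]]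
               |f1 f2 _ [c1 [k1 le1]] _ [c2 [k2 le2]]].
- by exists 1, 1 => n; rewrite mul1n expn1.
- by exists c, 0 => n; rewrite muln1.
- exists (c1 + c2), (k1 + k2) => n; rewrite mulnDl leq_add //.
    by apply: leq_trans (le1 n) _; rewrite leq_mul // leq_pexp2l // leq_addr.
  by apply: leq_trans (le2 n) _; rewrite leq_mul // leq_pexp2l // leq_addl.
- by exists (c1 * c2), (k1 + k2) => n; rewrite expnD mulnACA leq_mul.
Qed.

(** * Data encoded as trees, and the sizes of their codes *)

Structure encType := EncType { esort :> Type; enc : esort -> tree }.
Arguments EncType {esort} enc.

Canonical tree_encType := EncType (fun d : tree => d).
Canonical unit_encType := EncType (fun _ : unit => Nil).
Canonical bool_encType := EncType (fun b : bool => if b then Cons Nil Nil else Nil).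
Canonical nat_encType := EncType enc_nat.
Canonical prod_encType (A B : encType) :=
  EncType (fun p : A * B => Cons (enc p.1) (enc p.2)).
Canonical seq_encType (A : encType) := EncType (enc_seq (@enc A)).

Definition esize (T : encType) (x : T) : nat := tsize (enc x).

Lemma esize_pair (A B : encType) (p : A * B) :
  esize p = (esize p.1 + esize p.2).+1.
Proof. by []. Qed.

Lemma esize_nil (A : encType) : esize (@nil A) = 1.
Proof. by []. Qed.

Lemma esize_cons (A : encType) (a : A) l : esize (a :: l) = (esize a + esize l).+1.
Proof. by []. Qed.

Lemma esize_nat (n : nat) : esize n = n.*2.+1.
Proof.
rewrite /esize /=; elim: n => //= n IHn.
by rewrite -/(enc_nat n) IHn.
Qed.

Lemma esize_cat (A : encType) (l1 l2 : seq A) :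
  esize (l1 ++ l2) < esize l1 + esize l2.
Proof.
elim: l1 => [|a l1 IH]; rewrite ?esize_nil //= !esize_cons; lia.
Qed.

Lemma esize_filter (A : encType) (p : pred A) l : esize (filter p l) <= esize l.
Proof.
elim: l => //= a l IH; case: (p a); rewrite !esize_cons; lia.
Qed.

Lemma size_esize (A : encType) (l : seq A) : size l < esize l.
Proof. elim: l => //= a l IH; rewrite esize_cons; lia. Qed.

(* [n] is the largest variable that [p] may write to. *)
Definition ptime (X Y : encType) (f : X -> Y) : Prop :=
  exists (p : cmd) (n : nat) (q : nat -> nat), polynomial q /\
    forall x s, s 0 = enc x -> exists t s',
      [/\ exec p s t s', s' 0 = enc (f x), forall y, n < y -> s' y = s y,
          t <= q (esize x) & esize (f x) <= q (esize x)].

Lemma ptime_ext (X Y : encType) (f g : X -> Y) :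
  f =1 g -> ptime f -> ptime g.
Proof.
move=> fg [p [n [q [Pq H]]]]; exists p, n, q; split=> // x s sx.
by rewrite -fg; exact: H.
Qed.

(** The second program runs on [f x], whose size is bounded by the last clause of [ptime];
    monotonicity of [q2] then bounds its time by [q2 (q1 n)]. *)
Lemma ptime_comp (X Y Z : encType)
    (f : X -> Y) (g : Y -> Z) :
  ptime g -> ptime f -> ptime (fun x => g (f x)).
Proof.
move=> [p2 [n2 [q2 [Pq2 H2]]]] [p1 [n1 [q1 [Pq1 H1]]]].
exists (CSeq p1 p2), (maxn n1 n2), (fun n => q1 n + q2 (q1 n)); split.
  by apply: poly_add => //; exact: poly_comp.
move=> x s sx; have [t1 [s1 [e1 o1 k1 l1 b1]]] := H1 x s sx.
have [t2 [s2 [e2 o2 k2 l2 b2]]] := H2 (f x) s1 o1.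
have hom := poly_homo Pq2 b1.
exists (t1 + t2), s2; split => //; first exact: exec_seq e1 e2.
- move=> y; rewrite gtn_max => /andP[y1 y2]; by rewrite k2 ?k1.
- by rewrite leq_add // (leq_trans l2).
- lia.
Qed.

Lemma ptime_expr (X Y : encType) (f : X -> Y) (e : expr) q :
  polynomial q ->
  (forall x s, s 0 = enc x -> eval e s = enc (f x)) ->
  (forall x, esize (f x) <= q (esize x)) ->
  ptime f.
Proof.
move=> Pq He Hq; exists (CAssign 0 e), 0, (fun n => (ecost e).+1 + q n); split.
  by apply: poly_add Pq; exact: poly_const.
move=> x s sx; exists (ecost e).+1, (update s 0 (eval e s)); split.
- exact: exec_assign.
- by rewrite /update eqxx; exact: He.
- by move=> y; rewrite /update; case: y.
- exact: leq_addr.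
- by rewrite (leq_trans (Hq x)) ?leq_addl.
Qed.

Lemma ptime_id (X : encType) : ptime (fun x : X => x).
Proof. by apply: (@ptime_expr _ _ _ (EVar 0) _ poly_id). Qed.

(** For functions that only change the type under which a tree is read: a pair [(a, l)] and the list
    [a :: l] have the same code. *)
Lemma ptime_recode (X Y : encType) (f : X -> Y) :
  (forall x, enc (f x) = enc x) -> ptime f.
Proof.
move=> H; apply: (@ptime_expr _ _ _ (EVar 0) _ poly_id) => [x s /= ->|x] //.
by rewrite /esize H.
Qed.

Fixpoint tree_expr (d : tree) : expr :=
  if d is Cons a b then ECons (tree_expr a) (tree_expr b) else ENil.

Lemma ptime_const (X Y : encType) (y : Y) : ptime (fun _ : X => y).
Proof.
apply: (@ptime_expr _ _ _ (tree_expr (enc y)) _ (poly_const (esize y))) => //.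
by move=> x s _; elim: (enc y) => //= a -> b ->.
Qed.

Lemma ptime_fst (X Y Z : encType) (f : X -> Y * Z) :
  ptime f -> ptime (fun x => (f x).1).
Proof.
apply: (@ptime_comp _ _ _ f fst).
apply: (@ptime_expr _ _ _ (EHd (EVar 0)) _ poly_id) => [x s /= ->|x] //.
rewrite esize_pair; lia.
Qed.

Lemma ptime_snd (X Y Z : encType) (f : X -> Y * Z) :
  ptime f -> ptime (fun x => (f x).2).
Proof.
apply: (@ptime_comp _ _ _ f snd).
apply: (@ptime_expr _ _ _ (ETl (EVar 0)) _ poly_id) => [x s /= ->|x] //.
rewrite esize_pair; lia.
Qed.

Lemma updateE s x d : update s x d x = d.
Proof. by rewrite /update eqxx. Qed.

Lemma updateNE s x d y : y != x -> update s x d y = s y.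
Proof. by rewrite /update => /negbTE ->. Qed.

(** The input and the first result are saved in [N] and [N.+1], above every variable written by
    either program. This is why [ptime] quantifies over all initial stores and protects the
    variables above [n]. *)
Lemma ptime_pair (X Y Z : encType)
    (f : X -> Y) (g : X -> Z) :
  ptime f -> ptime g -> ptime (fun x => (f x, g x)).
Proof.
move=> [p1 [n1 [q1 [Pq1 H1]]]] [p2 [n2 [q2 [Pq2 H2]]]].
pose N := (maxn n1 n2).+1.
pose p := CSeq (CAssign N (EVar 0)) (CSeq p1 (CSeq (CAssign N.+1 (EVar 0))
  (CSeq (CAssign 0 (EVar N)) (CSeq p2 (CAssign 0 (ECons (EVar N.+1) (EVar 0))))))).
exists p, N.+1, (fun n => 10 + (q1 n + q2 n)); split.
  by apply: poly_add; [exact: poly_const | exact: poly_add].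
move=> x s sx.
pose s0 := update s N (s 0).
have [|t1 [s1 [e1 o1 k1 l1 b1]]] := H1 x s0; first by rewrite /s0 updateNE.
pose s2 := update s1 N.+1 (s1 0).
pose s3 := update s2 0 (s2 N).
have n1N : n1 < N by rewrite /N; lia.
have n2N : n2 < N by rewrite /N; lia.
have [|t2 [s4 [e2 o2 k2 l2 b2]]] := H2 x s3.
  rewrite /s3 updateE /s2 updateNE; last by rewrite neq_ltn ltnSn.
  by rewrite k1 ?/s0 ?updateE.
pose s5 := update s4 0 (Cons (s4 N.+1) (s4 0)).
exists (2 + (t1 + (2 + (2 + (t2 + 4))))), s5; split.
- by do 5![apply: exec_seq; first (exact: exec_assign || eassumption)]; exact: exec_assign.
- rewrite /s5 updateE o2 k2 /s3 /s2; last lia.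
  by rewrite updateNE // updateE o1.
- move=> y ltNy; rewrite /s5 updateNE; last lia.
  rewrite k2; last lia.
  rewrite /s3 updateNE; last lia.
  rewrite /s2 updateNE; last lia.
  rewrite k1; last lia.
  rewrite /s0 updateNE //; lia.
- lia.
- rewrite esize_pair /=; lia.
Qed.

Definition ptime2 (X Y Z : encType) (f : X -> Y -> Z) :=
  ptime (fun p : X * Y => f p.1 p.2).

Lemma ptime_comp2 (X Y1 Y2 Z : encType)
    (g : Y1 -> Y2 -> Z) (f1 : X -> Y1) (f2 : X -> Y2) :
  ptime2 g -> ptime f1 -> ptime f2 -> ptime (fun x => g (f1 x) (f2 x)).
Proof. by move=> Hg H1 H2; exact: (ptime_comp Hg (ptime_pair H1 H2)). Qed.

Lemma ptime_if (X Y : encType) (b : X -> bool) (f g : X -> Y) :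
  ptime b -> ptime f -> ptime g -> ptime (fun x => if b x then f x else g x).
Proof.
move=> Hb [p1 [n1 [q1 [Pq1 H1]]]] [p2 [n2 [q2 [Pq2 H2]]]].
(* The test is computed first and paired with the input, which thus survives it. *)
have Hif : ptime (fun y : bool * X => if y.1 then f y.2 else g y.2);
  last exact: (ptime_comp Hif (ptime_pair Hb (@ptime_id X))).
pose N := (maxn n1 n2).+1.
pose p := CSeq (CAssign N (EHd (EVar 0))) (CSeq (CAssign 0 (ETl (EVar 0)))
  (CIf (EVar N) p1 p2)).
exists p, N, (fun n => 8 + (q1 n + q2 n)); split.
  by apply: poly_add; [exact: poly_const | exact: poly_add].
case=> c x s; rewrite /enc /= => sx; rewrite !esize_pair /=.
pose s0 := update s N (thd (s 0)).
pose s1 := update s0 0 (ttl (s0 0)).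
have s1x : s1 0 = enc x by rewrite /s1 updateE /s0 updateNE // sx.
have s1N : s1 N = enc c by rewrite /s1 updateNE // /s0 updateE sx.
have mono1 : q1 (esize x) <= q1 (esize c + esize x).+1.
  apply: (poly_homo Pq1); lia.
have mono2 : q2 (esize x) <= q2 (esize c + esize x).+1.
  apply: (poly_homo Pq2); lia.
have keep y : N < y -> s1 y = s y.
  by move=> Ny; rewrite /s1 updateNE /s0 ?updateNE //; lia.
case: c s1N mono1 mono2 sx => s1N mono1 mono2 sx.
- have [t [s2 [e2 o2 k2 l2 b2]]] := H1 x s1 s1x.
  exists (3 + (3 + (2 + t))), s2; split => //=.
  + apply: exec_seq; first exact: exec_assign.
    apply: exec_seq; first exact: exec_assign.
    by apply: exec_if_true => //=; rewrite -/s0 -/s1 s1N.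
  + by move=> y Ny; rewrite k2 ?keep //; rewrite /N in Ny; lia.
  + lia.
  + lia.
- have [t [s2 [e2 o2 k2 l2 b2]]] := H2 x s1 s1x.
  exists (3 + (3 + (2 + t))), s2; split => //=.
  + apply: exec_seq; first exact: exec_assign.
    apply: exec_seq; first exact: exec_assign.
    by apply: exec_if_false => //=; rewrite -/s0 -/s1 s1N.
  + by move=> y Ny; rewrite k2 ?keep //; rewrite /N in Ny; lia.
  + lia.
  + lia.
Qed.

(* Trees share subtrees, so the size of a value is not bounded by the time spent
   computing it: loops need a separate bound on the growth of their state. *)
Definition additive_growth (X A S : encType)
    (st : X -> S -> A -> S) :=
  exists r, polynomial r /\
    forall x s a, esize (st x s a) <= esize s + r (esize x + esize a).

(** A while loop with the parameter [x] in [N], the remaining list in [N.+1] and the state in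
    [N.+2]. Additive growth keeps all states polynomially small, so every round is polynomial. *)
Lemma ptime_foldl (X A S : encType)
    (l : X -> seq A) (z : X -> S) (st : X -> S -> A -> S) :
  ptime l -> ptime z ->
  ptime (fun y : X * (A * S) => st y.1 y.2.2 y.2.1) ->
  additive_growth st ->
  ptime (fun x => foldl (st x) (z x) (l x)).
Proof.
move=> Hl Hz [p [n [q [Pq Hp]]]] [r [Pr Hr]].
have Hf : ptime (fun y : X * (seq A * S) => foldl (st y.1) y.2.2 y.2.1);
  last exact: (ptime_comp Hf (ptime_pair (@ptime_id X) (ptime_pair Hl Hz))).
pose N := n.+1.
pose body := CSeq (CAssign 0 (ECons (EVar N) (ECons (EHd (EVar N.+1)) (EVar N.+2))))
  (CSeq p (CSeq (CAssign N.+2 (EVar 0)) (CAssign N.+1 (ETl (EVar N.+1))))).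
pose loop := CWhile (EVar N.+1) body.
(* [L] bounds the size of the remaining list, [a0] the growth of the state in one round, and [B] all
   states to come. *)
have Hloop x L B a0 : forall la z0 s,
    s N = enc x -> s N.+1 = enc la -> s N.+2 = enc z0 ->
    (forall a : A, esize a <= L -> r (esize x + esize a) <= a0) ->
    esize la <= L -> esize z0 + size la * a0 <= B ->
    exists t s', [/\ exec loop s t s', s' N.+2 = enc (foldl (st x) z0 la),
      forall y, N.+2 < y -> s' y = s y,
      t <= 2 + size la * (20 + q (2 + (esize x + (L + B)))) &
      esize (foldl (st x) z0 la) <= B].
  elim=> [|a la IH] z0 s sx sl sz Ha0 leL leB.
    exists 2, s; split => //=; first exact: exec_while_false.
    by rewrite addn0 in leB.
  rewrite /= mulSn in leB; rewrite esize_cons in leL.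
  pose s0 := update s 0 (Cons (enc x) (Cons (enc a) (enc z0))).
  have [|t [s1 [e1 o1 k1 l1 b1]]] := Hp (x, (a, z0)) s0; first exact: updateE.
  pose s2 := update s1 N.+2 (s1 0).
  pose s3 := update s2 N.+1 (ttl (s2 N.+1)).
  have ra : r (esize x + esize a) <= a0 by apply: Ha0; lia.
  have rz := Hr x z0 a.
  have [| | | | | |t' [s' [e' o' k' l' b']]] := IH (st x z0 a) s3 => //.
  + rewrite /s3 updateNE; last lia.
    rewrite /s2 updateNE; last lia.
    by rewrite k1 // /s0 updateNE.
  + rewrite /s3 updateE /s2 updateNE; last lia.
    rewrite k1; last (rewrite /N; lia).
    by rewrite /s0 updateNE // sl.
  + rewrite /s3 updateNE; last lia.
    by rewrite /s2 updateE o1.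
  + lia.
  + lia.
  + have mono : q (esize (x, (a, z0))) <= q (2 + (esize x + (L + B))).
      apply: (poly_homo Pq); rewrite !esize_pair /=; lia.
    exists (2 + (7 + (t + (2 + 3))) + t'), s'; split => //.
    * apply: exec_while_true e'; first by rewrite /= sl.
      apply: exec_seq; first exact: exec_assign.
      rewrite /= sx sl sz; apply: exec_seq; first exact: e1.
      by apply: exec_seq; exact: exec_assign.
    * move=> y Ny; rewrite k' //.
      rewrite /s3 updateNE; last lia.
      rewrite /s2 updateNE; last lia.
      rewrite k1; last (rewrite /N in Ny; lia).
      rewrite /s0 updateNE //; lia.
    * rewrite /= mulSn; lia.
pose pg := CSeq (CAssign N (EHd (EVar 0))) (CSeq (CAssign N.+1 (EHd (ETl (EVar 0))))
  (CSeq (CAssign N.+2 (ETl (ETl (EVar 0)))) (CSeq loop (CAssign 0 (EVar N.+2))))).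
(* The size of the initial state, plus at most [n] rounds that add at most [r n] each. *)
pose B n := n + n * r n.
exists pg, N.+2, (fun n => (30 + n * (20 + q (2 + (n + (n + B n))))) + B n).
have PB : polynomial B by do !(constructor || exact: Pr).
split.
  apply: poly_add PB; apply: poly_add; first exact: poly_const.
  apply: poly_mul; first exact: poly_id.
  apply: poly_add; first exact: poly_const.
  apply: poly_comp Pq _.
  by apply: poly_add; [exact: poly_const | do !(exact: PB || constructor)].
case=> x [la z0] s sx; rewrite /= in sx *.
set M := esize (x, (la, z0)).
have EM : M = (esize x + (esize la + esize z0).+1).+1 by [].
pose s0 := update s N (enc x).
pose s1 := update s0 N.+1 (enc la).
pose s2 := update s1 N.+2 (enc z0).
have lelaM : size la < M by have := size_esize la; lia.
have [| | | | | |t [s3 [e3 o3 k3 l3 b3]]] :=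
    Hloop x (esize la) (B M) (r M) la z0 s2.
- rewrite /s2 updateNE; last lia.
  rewrite /s1 updateNE; last lia.
  by rewrite /s0 updateE.
- rewrite /s2 updateNE; last lia.
  by rewrite /s1 updateE.
- by rewrite /s2 updateE.
- move=> a leaM; apply: (poly_homo Pr); lia.
- by [].
- rewrite /B leq_add //; last by rewrite leq_mul //; lia.
  lia.
have mono : q (2 + (esize x + (esize la + B M))) <= q (2 + (M + (M + B M))).
  apply: (poly_homo Pq); lia.
exists (3 + (4 + (4 + (t + 2)))), (update s3 0 (s3 N.+2)); split.
- apply: exec_seq; first exact: exec_assign.
  rewrite /= sx /= -/s0; apply: exec_seq; first exact: exec_assign.
  rewrite /= [s0 0]updateNE // sx /= -/s1.
  apply: exec_seq; first exact: exec_assign.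
  rewrite /= [s1 0]updateNE // [s0 0]updateNE // sx /= -/s2.
  by apply: exec_seq e3 _; exact: exec_assign.
- by rewrite updateE.
- move=> y Ny; rewrite updateNE; last lia.
  rewrite k3 // /s2 updateNE; last lia.
  rewrite /s1 updateNE; last lia.
  rewrite /s0 updateNE //; lia.
- have : size la * (20 + q (2 + (esize x + (esize la + B M)))) <=
         M * (20 + q (2 + (M + (M + B M)))) by rewrite leq_mul //; lia.
  lia.
- lia.
Qed.

(** * Arithmetic and lists *)

(** Isolates the size clause of [ptime], which gives the growth bound of the loop in [ptime_map]. *)
Lemma ptime2_size (X Y Z : encType) (f : X -> Y -> Z) :
  ptime2 f -> exists r, polynomial r /\
    forall x y, esize (f x y) <= r (esize x + esize y).
Proof.
move=> [p [n [q [Pq H]]]]; exists (fun m => q (m + 1)); split.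
  by apply: poly_comp Pq _; do !constructor.
move=> x y; have [t [s [_ _ _ _]]] := H (x, y) (fun=> enc (x, y)) erefl.
by rewrite esize_pair addn1.
Qed.

Lemma ptime_succ (X : encType) (f : X -> nat) : ptime f -> ptime (fun x => (f x).+1).
Proof.
apply: (@ptime_comp _ _ _ f S).
apply: (@ptime_expr _ _ _ (ECons ENil (EVar 0)) _ (poly_add poly_id (poly_const 2))).
  by move=> x s /= ->.
by move=> x; rewrite !esize_nat; lia.
Qed.

Lemma ptime_pred (X : encType) (f : X -> nat) : ptime f -> ptime (fun x => (f x).-1).
Proof.
apply: (@ptime_comp _ _ _ f predn).
apply: (@ptime_expr _ _ _ (ETl (EVar 0)) _ poly_id).
  (* The convention [ttl Nil = Nil] matches [0.-1 = 0]. *)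
  by move=> [|x] s /= ->.
by move=> x; rewrite !esize_nat; lia.
Qed.

Lemma ptime_behead (X A : encType) (f : X -> seq A) :
  ptime f -> ptime (fun x => behead (f x)).
Proof.
apply: (@ptime_comp _ _ _ f behead).
apply: (@ptime_expr _ _ _ (ETl (EVar 0)) _ poly_id).
  by move=> [|a l] s /= ->.
by move=> [|a l] //=; rewrite esize_cons; lia.
Qed.

Lemma ptime_head_nil (X A : encType) (f : X -> seq (seq A)) :
  ptime f -> ptime (fun x => head [::] (f x)).
Proof.
apply: (@ptime_comp _ _ _ f (head [::])).
apply: (@ptime_expr _ _ _ (EHd (EVar 0)) _ poly_id).
  by move=> [|a l] s /= ->.
by move=> [|a l] //=; rewrite esize_cons; lia.
Qed.

Lemma ptime_cons (X A : encType) (f : X -> A) (g : X -> seq A) :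
  ptime f -> ptime g -> ptime (fun x => f x :: g x).
Proof.
by apply: (@ptime_comp2 _ _ _ _ cons); apply: ptime_recode.
Qed.

Ltac ptime_proj :=
  repeat first [ exact: ptime_id | apply: ptime_fst | apply: ptime_snd
               | apply: ptime_pair ].

Lemma ptime_rev (X A : encType) (f : X -> seq A) : ptime f -> ptime (fun x => rev (f x)).
Proof.
move=> Hf; apply: (@ptime_ext _ _ (fun x => foldl (fun s a => a :: s) [::] (f x))).
  by move=> x; rewrite /rev; elim: (f x) [::] => //= a l IH z; rewrite IH.
apply: (ptime_foldl (st := fun x s a => a :: s)) => //.
- exact: ptime_const.
- by apply: ptime_cons; ptime_proj.
- exists (fun n => n + 1); split; first by do !constructor.
  by move=> x s a; rewrite esize_cons; lia.
Qed.

Lemma ptime_foldr (X A S : encType)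
    (l : X -> seq A) (z : X -> S) (st : X -> A -> S -> S) :
  ptime l -> ptime z ->
  ptime (fun y : X * (A * S) => st y.1 y.2.1 y.2.2) ->
  additive_growth (fun x s a => st x a s) ->
  ptime (fun x => foldr (st x) (z x) (l x)).
Proof.
move=> Hl Hz Hst Hg.
apply: (@ptime_ext _ _ (fun x => foldl (fun s a => st x a s) (z x) (rev (l x)))).
  by move=> x; rewrite foldl_rev.
by apply: (ptime_foldl (st := fun x s a => st x a s)) => //; exact: ptime_rev.
Qed.

Lemma ptime_map (X A B : encType) (l : X -> seq A) (f : X -> A -> B) :
  ptime2 f -> ptime l -> ptime (fun x => [seq f x a | a <- l x]).
Proof.
move=> Hf Hl; have [r [Pr Hr]] := ptime2_size Hf.
apply: (ptime_foldr (st := fun x a s => f x a :: s)) => //.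
- exact: ptime_const.
- by apply: ptime_cons; [apply: (ptime_comp2 Hf)|]; ptime_proj.
- exists (fun n => r n + 1); split; first by do !(assumption || constructor).
  by move=> x s a; rewrite esize_cons; have := Hr x a; lia.
Qed.

Lemma ptime_cat (X A : encType) (f g : X -> seq A) :
  ptime f -> ptime g -> ptime (fun x => f x ++ g x).
Proof.
move=> Hf Hg; apply: (@ptime_ext _ _ (fun x => foldr cons (g x) (f x))).
  by move=> x; elim: (f x) => //= a l ->.
apply: (ptime_foldr (st := fun x a s => a :: s)) => //.
- by apply: ptime_cons; ptime_proj.
- exists (fun n => n + 1); split; first by do !constructor.
  by move=> x s a; rewrite esize_cons; lia.
Qed.

Lemma ptime_filter (X A : encType) (l : X -> seq A) (f : X -> A -> bool) :
  ptime2 f -> ptime l -> ptime (fun x => [seq a <- l x | f x a]).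
Proof.
move=> Hf Hl; apply: (ptime_foldr (st := fun x a s => if f x a then a :: s else s)) => //.
- exact: ptime_const.
- by apply: ptime_if; [apply: (ptime_comp2 Hf)|apply: ptime_cons|]; ptime_proj.
- exists (fun n => n + 1); split; first by do !constructor.
  by move=> x s a; case: (f x a); rewrite ?esize_cons; lia.
Qed.

Lemma ptime_flatten (X A : encType) (f : X -> seq (seq A)) :
  ptime f -> ptime (fun x => flatten (f x)).
Proof.
move=> Hf; apply: (ptime_foldr (st := fun x a s => a ++ s)) => //.
- exact: ptime_const.
- by apply: ptime_cat; ptime_proj.
- exists (fun n => n); split; first by do !constructor.
  by move=> x s a; have := esize_cat a s; lia.
Qed.

Lemma ptime_negb (X : encType) (b : X -> bool) : ptime b -> ptime (fun x => ~~ b x).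
Proof. by move=> Hb; apply: ptime_if => //; exact: ptime_const. Qed.

Lemma ptime_andb (X : encType) (b c : X -> bool) :
  ptime b -> ptime c -> ptime (fun x => b x && c x).
Proof. by move=> Hb Hc; apply: ptime_if => //; exact: ptime_const. Qed.

Lemma ptime_has (X A : encType) (l : X -> seq A) (f : X -> A -> bool) :
  ptime2 f -> ptime l -> ptime (fun x => has (f x) (l x)).
Proof.
move=> Hf Hl; apply: (@ptime_ext _ _
  (fun x => foldr (fun a b => if f x a then true else b) false (l x))).
  by move=> x; elim: (l x) => //= a s ->; case: (f x a).
apply: (ptime_foldr (st := fun x a (s : bool) => if f x a then true else s)) => //.
- exact: ptime_const.
- by apply: ptime_if; [apply: (ptime_comp2 Hf)|exact: ptime_const|]; ptime_proj.
- exists (fun=> 3); split; first by do !constructor.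
  by move=> x s a; case: (f x a); [exact: leq_addl | exact: leq_addr].
Qed.

Lemma ptime_all (X A : encType) (l : X -> seq A) (f : X -> A -> bool) :
  ptime2 f -> ptime l -> ptime (fun x => all (f x) (l x)).
Proof.
move=> Hf Hl; apply: (@ptime_ext _ _ (fun x => ~~ has (fun a => ~~ f x a) (l x))).
  by move=> x; rewrite -all_predC; apply: eq_all => a /=; rewrite negbK.
apply: ptime_negb; apply: (ptime_has (f := fun x a => ~~ f x a)) => //.
exact: ptime_negb.
Qed.

Lemma ptime_nilp (X A : encType) (l : X -> seq A) : ptime l -> ptime (fun x => nilp (l x)).
Proof.
move=> Hl; apply: (@ptime_ext _ _ (fun x => ~~ has (fun=> true) (l x))).
  by move=> x; case: (l x).
by apply: ptime_negb; apply: (ptime_has (f := fun _ _ => true)) => //; exact: ptime_const.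
Qed.

(** A unary number is the same tree as a list of that many units, so a counted loop is a fold over
    such a list. *)
Lemma ptime_nseq (X : encType) (n : X -> nat) : ptime n -> ptime (fun x => nseq (n x) tt).
Proof.
apply: (@ptime_comp _ _ _ n (fun m => nseq m tt)); apply: ptime_recode => m.
by elim: m => //= m ->.
Qed.

Lemma ptime_size (X A : encType) (l : X -> seq A) : ptime l -> ptime (fun x => size (l x)).
Proof.
move=> Hl; apply: (@ptime_ext _ _ (fun x => foldr (fun _ n => n.+1) 0 (l x))).
  by move=> x; elim: (l x) => //= a s ->.
apply: (ptime_foldr (st := fun _ _ n => n.+1)) => //.
- exact: ptime_const.
- by apply: ptime_succ; ptime_proj.
- exists (fun=> 2); split; first by do !constructor.
  by move=> x s a; rewrite !esize_nat; lia.
Qed.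

Lemma ptime_count (X A : encType) (l : X -> seq A) (f : X -> A -> bool) :
  ptime2 f -> ptime l -> ptime (fun x => count (f x) (l x)).
Proof.
move=> Hf Hl; apply: (@ptime_ext _ _ (fun x => size (filter (f x) (l x)))).
  by move=> x; rewrite size_filter.
by apply: ptime_size; exact: ptime_filter.
Qed.

Lemma ptime_iter (X S : encType) (n : X -> nat) (z : X -> S) (f : X -> S -> S) r :
  ptime n -> ptime z -> ptime2 f ->
  polynomial r -> (forall x s, esize (f x s) <= esize s + r (esize x)) ->
  ptime (fun x => iter (n x) (f x) (z x)).
Proof.
move=> Hn Hz Hf Pr Hr.
apply: (@ptime_ext _ _ (fun x => foldr (fun _ => f x) (z x) (nseq (n x) tt))).
  by move=> x; elim: (n x) => //= m ->.
apply: (ptime_foldr (st := fun x _ => f x)) => //; first exact: ptime_nseq.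
- by apply: (ptime_comp2 Hf); ptime_proj.
- exists r; split => // x s a; apply: leq_trans (Hr x s) _.
  by rewrite leq_add2l; apply: (poly_homo Pr); rewrite leq_addr.
Qed.

Lemma ptime_addn (X : encType) (f g : X -> nat) :
  ptime f -> ptime g -> ptime (fun x => f x + g x).
Proof.
move=> Hf Hg; apply: (@ptime_ext _ _ (fun x => iter (f x) (fun n => n.+1) (g x))).
  by move=> x; elim: (f x) => //= n ->.
apply: (ptime_iter (f := fun _ n => n.+1) (r := fun=> 2)) => //.
- by apply: ptime_succ; ptime_proj.
- exact: poly_const.
- by move=> x s; rewrite !esize_nat; lia.
Qed.

Lemma ptime_subn (X : encType) (f g : X -> nat) :
  ptime f -> ptime g -> ptime (fun x => f x - g x).
Proof.
move=> Hf Hg; apply: (@ptime_ext _ _ (fun x => iter (g x) (fun n => n.-1) (f x))).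
  by move=> x; elim: (g x) => /= [|n ->]; lia.
apply: (ptime_iter (f := fun _ n => n.-1) (r := fun=> 2)) => //.
- by apply: ptime_pred; ptime_proj.
- exact: poly_const.
- by move=> x s; rewrite !esize_nat; lia.
Qed.

Lemma ptime_muln (X : encType) (f g : X -> nat) :
  ptime f -> ptime g -> ptime (fun x => f x * g x).
Proof.
move=> Hf Hg; apply: (@ptime_comp2 _ _ _ _ muln) => //.
apply: (@ptime_ext _ _ (fun x => iter x.1 (addn x.2) 0)).
  by move=> x; elim: (x.1) => //= n ->.
apply: (ptime_iter (f := fun x n => x.2 + n) (r := fun n => n)) => //.
- by ptime_proj.
- exact: ptime_const.
- by apply: ptime_addn; ptime_proj.
- exact: poly_id.
- by move=> x s; rewrite esize_pair !esize_nat; lia.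
Qed.

Lemma ptime_leq (X : encType) (f g : X -> nat) :
  ptime f -> ptime g -> ptime (fun x => f x <= g x).
Proof.
move=> Hf Hg; apply: (@ptime_ext _ _ (fun x => nilp (nseq (f x - g x) tt))).
  by move=> x; rewrite /nilp size_nseq.
by apply: ptime_nilp; apply: ptime_nseq; exact: ptime_subn.
Qed.

Lemma ptime_eqn (X : encType) (f g : X -> nat) :
  ptime f -> ptime g -> ptime (fun x => f x == g x).
Proof.
move=> Hf Hg; apply: (@ptime_ext _ _ (fun x => (f x <= g x) && (g x <= f x))).
  by move=> x; rewrite eqn_leq.
by apply: ptime_andb; exact: ptime_leq.
Qed.

Lemma ptime_mem (X : encType) (f : X -> nat) (l : X -> seq nat) :
  ptime f -> ptime l -> ptime (fun x => f x \in l x).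
Proof.
move=> Hf Hl; apply: (@ptime_comp2 _ _ _ _ (fun n (s : seq nat) => n \in s)) => //.
apply: (@ptime_ext _ _ (fun x : nat * seq nat => has (fun m => m == x.1) x.2)).
  by move=> x; rewrite has_pred1.
apply: (ptime_has (f := fun (x : nat * seq nat) (m : nat) => m == x.1)).
  by apply: ptime_eqn; ptime_proj.
by ptime_proj.
Qed.

Lemma ptime_index (X : encType) (f : X -> nat) (l : X -> seq nat) :
  ptime f -> ptime l -> ptime (fun x => index (f x) (l x)).
Proof.
move=> Hf Hl; apply: (@ptime_comp2 _ _ _ _ (fun (n : nat) (s : seq nat) => index n s)) => //.
apply: (@ptime_ext _ _ (fun x : nat * seq nat =>
  foldr (fun m n => if m == x.1 then 0 else n.+1) 0 x.2)).
  by move=> [n l']; elim: l' => //= m s ->.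
apply: (ptime_foldr (st := fun (x : nat * seq nat) (m : nat) n =>
  if m == x.1 then 0 else n.+1)).
- by ptime_proj.
- exact: ptime_const.
- by apply: ptime_if; [apply: ptime_eqn|exact: ptime_const|apply: ptime_succ]; ptime_proj.
- exists (fun=> 2); split; first by do !constructor.
  by move=> x s a; case: ifP => _; rewrite !esize_nat; lia.
Qed.

Lemma ptime_nth (X A : encType) (n : X -> nat) (l : X -> seq (seq A)) :
  ptime n -> ptime l -> ptime (fun x => nth [::] (l x) (n x)).
Proof.
move=> Hn Hl; apply: (@ptime_ext _ _ (fun x => head [::] (iter (n x) behead (l x)))).
  move=> x; rewrite -nth0; suff -> : iter (n x) behead (l x) = drop (n x) (l x).
    by rewrite nth_drop addn0.
  by elim: (n x) => [|m /= ->]; rewrite ?drop0 // -drop1 drop_drop add1n.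
apply: ptime_head_nil; apply: (ptime_iter (f := fun _ => behead) (r := fun=> 0)) => //.
- by apply: ptime_behead; ptime_proj.
- exact: poly_const.
- by move=> x [|a s] //=; rewrite esize_cons; lia.
Qed.

Lemma ptime_sumn (X : encType) (l : X -> seq nat) : ptime l -> ptime (fun x => sumn (l x)).
Proof.
move=> Hl; apply: (ptime_foldr (st := fun _ a s => a + s)) => //.
- exact: ptime_const.
- by apply: ptime_addn; ptime_proj.
- exists (fun n => n); split; first exact: poly_id.
  by move=> x s a; rewrite !esize_nat; lia.
Qed.

(** * The auction *)

(* A state of the auction is the current matching together with the list of all
   men won so far, repetitions included: the price of a man is his multiplicity
   in it. *)
Definition gain (st : seq (nat * nat) * seq nat) (e : nat * nat * nat) : nat :=
  if e.1.2 \in [seq p.2 | p <- st.1] then 0 else e.2 - count_mem e.1.1 st.2.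

(** The start value [(0, 0, 0)] has gain zero in every state, so it cannot displace an edge of
    positive gain. *)
Definition best_edge (E : seq (nat * nat * nat)) st : nat * nat * nat :=
  foldl (fun b e => if gain st b < gain st e then e else b) (0, 0, 0) E.

(** The man of the best edge leaves any former partner and his price rises by one. A state without
    positive gain is a fixed point, so surplus rounds are harmless. *)
Definition bid (E : seq (nat * nat * nat)) st :=
  if 0 < gain st (best_edge E st) then
    ((best_edge E st).1 :: [seq p <- st.1 | p.1 != (best_edge E st).1.1],
     (best_edge E st).1.1 :: st.2)
  else st.

(** Every effective round raises the total price by one, and that total never exceeds the sum of all
    weights; this many rounds therefore reach a fixed point. *)
Definition auction (E : seq (nat * nat * nat)) : seq (nat * nat) :=
  (iter (sumn [seq e.2 | e <- E]) (bid E) ([::], [::])).1.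

Lemma gain0 st : gain st (0, 0, 0) = 0.
Proof. by rewrite /gain /= sub0n if_same. Qed.

Lemma best_edgeP E st :
  (forall e, e \in E -> gain st e <= gain st (best_edge E st)) /\
  (0 < gain st (best_edge E st) -> best_edge E st \in E).
Proof.
rewrite /best_edge; set b0 := (0, 0, 0); set f := (X in foldl X).
suff H b : [/\ gain st b <= gain st (foldl f b E),
    forall e, e \in E -> gain st e <= gain st (foldl f b E) &
    foldl f b E \in b :: E].
  have [_ H1 H2] := H b0; split => //; move: H2; rewrite inE => /orP[/eqP->|//].
  by rewrite gain0.
elim: E b => [|e E IH] b /=; first by rewrite mem_head.
set b' := f b e; have [H1 H2 H3] := IH b'.
have [lbb' leb'] : gain st b <= gain st b' /\ gain st e <= gain st b'.
  by rewrite /b' /f; case: ltnP => // /ltnW.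
split; first exact: leq_trans H1.
  by move=> x; rewrite inE => /orP[/eqP->|/H2//]; exact: leq_trans H1.
move: H3; rewrite !inE => /orP[/eqP->|->]; last by rewrite !orbT.
by rewrite /b' /f; case: ifP; rewrite eqxx ?orbT.
Qed.

Lemma sum_count_mem (T : eqType) (s H : seq T) :
  uniq s -> \sum_(x <- s) count_mem x H = count (mem s) H.
Proof.
move=> us; elim: H => [|h H IH] /=; first by rewrite big1.
rewrite big_split /= IH -(count_uniq_mem h us) -(sum1_count s (pred1 h)).
rewrite [in RHS]big_mkcond /=.
by congr (_ + _); apply: eq_bigr => x _; rewrite eq_sym; case: (h == x).
Qed.

Section Auction.

Variables (P : seq (nat * nat)) (w : nat * nat -> nat).
Let E := [seq (e, w e) | e <- P].

(** Beyond being a matching inside [P]: only matched men have a positive price, no price exceeds the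
    weight of the man's pair, and complementary slackness holds up to one, that is, no other edge of
    a matched woman beats her own margin (weight minus price) by more than one. *)
Definition auction_inv (st : seq (nat * nat) * seq nat) :=
  [/\ uniq [seq p.1 | p <- st.1], uniq [seq p.2 | p <- st.1],
      {subset st.1 <= P}, {subset st.2 <= [seq p.1 | p <- st.1]} &
      (forall p, p \in st.1 -> count_mem p.1 st.2 <= w p) /\
      (forall p q, p \in st.1 -> q \in P -> q.2 = p.2 ->
         w q + count_mem p.1 st.2 <= w p + count_mem q.1 st.2 + 1)].

Lemma bid_inv st : auction_inv st -> auction_inv (bid E st).
Proof.
move=> inv; rewrite /bid; case: ifPn => // gain_gt0; move: inv.
have [bestP /(_ gain_gt0)] := best_edgeP E st.
move: (best_edge E st) bestP gain_gt0 => b bestP + /mapP[[m v] mvP Eb].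
rewrite {b}Eb in bestP *; case: st bestP => A H; rewrite /gain /=.
case: ifP => // vA bestP; rewrite subn_gt0 => m_lt.
move=> [/= uA1 uA2 AP HA [leA csA]].
have fltP p : p \in [seq p <- A | p.1 != m] -> p.1 != m /\ p \in A.
  by rewrite mem_filter => /andP.
split => /=.
- rewrite (subseq_uniq (map_subseq _ (filter_subseq _ _))) // andbT.
  by apply/negP => /mapP[p /fltP[pm _] Em]; rewrite Em eqxx in pm.
- rewrite (subseq_uniq (map_subseq _ (filter_subseq _ _))) // andbT.
  by apply/negP => /mapP[p /fltP[_ pA] Ev]; move: vA; rewrite Ev map_f.
- by move=> p; rewrite inE => /orP[/eqP-> //|/fltP[_ /AP]].
(* A man once matched stays matched: only the old pair of [m] is dropped, and [m] is matched
   anew. *)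
- move=> h; rewrite !inE; have [//|hm] := eqVneq h m; move=> /= /HA /mapP[p pA Eh].
  by apply/mapP; exists p; rewrite // mem_filter pA -Eh hm.
- split=> [p|p q]; rewrite inE => /orP[/eqP->|/fltP[pm pA]] /=.
  + by rewrite eqxx.
  + by rewrite eq_sym (negbTE pm) leA.
  (* The new edge was the best one before its own price rose by one, which is the slack allowed. *)
  + move=> qP qv; have := bestP (q, w q) (map_f _ qP); rewrite /= qv vA.
    rewrite eqxx; lia.
  (* The price in [p] is unchanged and the one in [q] can only rise, so the old inequality
     persists. *)
  + move=> qP qv; have := csA p q pA qP qv; rewrite [m == p.1]eq_sym (negbTE pm); lia.
Qed.

(** The length of [st.2] is the total price, which is carried by matched men and bounded pair by
    pair by the weights. *)
Lemma auction_inv_size st : auction_inv st -> size st.2 <= sumn [seq e.2 | e <- E].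
Proof.
case: st => A H [/= uA1 uA2 AP HA [leA _]].
have -> : size H = \sum_(p <- A) count_mem p.1 H.
  rewrite -(big_map fst xpredT (fun m => count_mem m H)) sum_count_mem //.
  by apply/esym/eqP; rewrite -all_count; apply/allP.
apply: leq_trans (_ : \sum_(p <- A) w p <= _).
  by rewrite big_seq [leqRHS]big_seq; apply: leq_sum => p; exact: leA.
rewrite sumnE /E -map_comp big_map.
apply: sub_le_big_seq => //; first by move=> *; exact: leq_addr.
(* [P] may list a pair several times, whereas [A] lists it at most once. *)
move=> p; rewrite count_uniq_mem ?(map_uniq uA1) //.
by case pA : (p \in A) => //; rewrite -has_count has_pred1 AP.
Qed.

Lemma auctionP (A := auction E) :
  [/\ uniq [seq p.1 | p <- A], uniq [seq p.2 | p <- A], {subset A <= P} &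
      forall B, uniq [seq p.1 | p <- B] -> uniq [seq p.2 | p <- B] ->
        {subset B <= P} ->
        \sum_(p <- B) w p <= \sum_(p <- A) w p + size B].
Proof.
rewrite /A /auction; set T := sumn _.
pose st i := iter i (bid E) ([::], [::]).
have stS i : st i.+1 = bid E (st i) by [].
have inv i : auction_inv (st i).
  elim: i => [|i IH]; last exact: bid_inv.
  by split => //; split.
have bid_dich s : gain s (best_edge E s) = 0 /\ bid E s = s \/
    size (bid E s).2 = (size s.2).+1.
  rewrite /bid; case: ifP => [_|/negbT]; first by right.
  by rewrite lt0n negbK => /eqP; left.
(* Otherwise all of the first [T.+1] rounds are effective and the total price exceeds its bound
   [T]. *)
have stop : gain (st T) (best_edge E (st T)) = 0.
  have [[]//|szS] := bid_dich (st T).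
  have szi i : bid E (st i) = st i \/ size (st i).2 = i.
    elim: i => [|i IH]; first by right.
    rewrite stS; case: IH => [Ei|IH]; first by left; rewrite !Ei.
    have [[_ Ei]|] := bid_dich (st i); first by left; rewrite !Ei.
    by rewrite IH; right.
  have := auction_inv_size (inv T.+1); rewrite -/T stS szS.
  have [ET|->] := szi T; last by rewrite ltnn.
  by move: szS; rewrite ET; lia.
have [uA1 uA2 AP HA [leA csA]] := inv T.
have [bestP _] := best_edgeP E (st T).
rewrite stop /gain in bestP; rewrite -/(st T).
set A' := (st T).1 in uA1 uA2 AP HA leA csA bestP *.
set H := (st T).2 in HA leA csA bestP.
split=> // B uB1 uB2 BP.
pose pr m := count_mem m H.
(* weak LP duality, [pr] and [u] being the dual variables of men and women *)
pose u v := \sum_(p <- A' | p.2 == v) (w p - pr p.1).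
(* Dual feasibility up to one: by approximate slackness if the woman is matched, and because her
   gain is zero if she is not. *)
have wB p : p \in P -> w p <= u p.2 + pr p.1 + 1.
  move=> pP; have := bestP (p, w p) (map_f _ pP); rewrite /=.
  case: ifP => [/mapP[q qA Eq] _ | _]; last by rewrite -/(pr p.1); move: (pr _) (u _) => c d; lia.
  rewrite /u (big_rem q) //= Eq eqxx.
  have := csA q p qA pP Eq; have := leA q qA; rewrite -!/(pr _).
  by move: (pr q.1) (pr p.1) (\sum_(_ <- _ | _) _) => a b c; lia.
(* The men of [A'] carry the whole price, those of [B] at most that. *)
have sum_pr : \sum_(p <- B) pr p.1 <= \sum_(p <- A') pr p.1.
  rewrite -(big_map fst xpredT pr) -[leqRHS](big_map fst xpredT pr).
  rewrite !sum_count_mem //.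
  by rewrite (@eq_in_count _ (mem [seq p.1 | p <- A']) predT) ?count_predT ?count_size.
have sum_u : \sum_(p <- B) u p.2 <= \sum_(p <- A') (w p - pr p.1).
  under eq_bigr do rewrite /u big_mkcond.
  rewrite exchange_big /=; apply: leq_sum => q _.
  rewrite -big_mkcond /= -(big_map snd (fun v => q.2 == v) (fun=> w q - pr q.1)).
  rewrite big_const_seq iter_addn_0.
  rewrite (@eq_count _ _ (pred1 q.2)); last by move=> v; rewrite /= eq_sym.
  by rewrite count_uniq_mem // -{2}[w q - _]muln1 leq_mul // leq_b1.
(* The weight of [A'] equals the dual objective, since no subtraction is truncated. *)
have sum_A : \sum_(p <- A') w p =
    \sum_(p <- A') (w p - pr p.1) + \sum_(p <- A') pr p.1.
  rewrite -big_split /= big_seq [RHS]big_seq; apply: eq_bigr => p pA.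
  by rewrite subnK ?leA.
apply: (@leq_trans (\sum_(p <- B) (u p.2 + pr p.1 + 1))).
  by rewrite big_seq [leqRHS]big_seq; apply: leq_sum => p /BP; exact: wB.
by rewrite !big_split /= sum1_size sum_A leq_add2r leq_add.
Qed.

End Auction.

(** * Blocking pairs and weights *)

(** Comparison of leading digits in base [K]: a low digit [d] below [K] cannot make up for a smaller
    leading digit. *)
Lemma lex_leq K x y c d : K * x + c <= K * y + d -> d < K -> x <= y.
Proof.
move=> le_xy ltd; case: (leqP x y) => // lt_yx.
have : K * y + K <= K * x by rewrite addnC -mulnS leq_mul.
by move: le_xy ltd; move: (K * x) (K * y) => a b; lia.
Qed.

Lemma index_filter_head (T : eqType) (a : pred T) (l : seq T) x y :
  x \in filter a l -> index x (filter a l) = 0 -> y \in filter a l ->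
  index x l <= index y l.
Proof.
elim: l => //= z l IH; case: ifP => [_ _|az xl x0 yl].
  by rewrite /= ; case: eqVneq.
have [zx|_] := eqVneq z x; first by [].
have [zy|_] := eqVneq z y; last by rewrite ltnS IH.
by move: yl; rewrite -zy mem_filter az.
Qed.

Section Weights.

Variable I : smc.
Variable K : nat.

Implicit Types (S : {set man I * woman I}) (m : man I) (w : woman I).

Definition first_choice m w : bool :=
  let l := [seq w' <- mlist m | m \in wlist w'] in (w \in l) && (index w l == 0).

Definition wrank w m : nat := index m (wlist w).

(** The first-choice men of [w] who do not block with her when [m] is her partner. *)
Definition wsatisfied w m : {set man I} :=
  [set m' | first_choice m' w & wrank w m <= wrank w m'].

(* A number with three digits in base [K], as [K] exceeds the sum of the last two
   digits over any matching: the first one counts distinguished women, the second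
   one non-blocking first-choice pairs, and the last one grows with the women's
   satisfaction. *)
Definition weight (p : man I * woman I) : nat :=
  K * (K * (p.2 \in wstar I) + #|wsatisfied p.2 p.1|)
  + (size (wlist p.2) - wrank p.2 p.1).

Lemma first_choice_acceptable m w : first_choice m w -> acceptable m w.
Proof. by case/andP; rewrite mem_filter /acceptable andbC. Qed.

Lemma first_choice_le m w w' :
  first_choice m w -> acceptable m w' -> index w (mlist m) <= index w' (mlist m).
Proof.
case/andP=> wl /eqP w0; rewrite /acceptable andbC -(mem_filter (fun w => m \in wlist w)).
exact: index_filter_head.
Qed.

Lemma first_choice_ex m w : acceptable m w -> exists w', first_choice m w'.
Proof.
rewrite /acceptable andbC -(mem_filter (fun w => m \in wlist w)) => wl.
rewrite /first_choice; case: [seq _ <- _ | _] wl => // w' l _.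
by exists w'; rewrite mem_head /= eqxx.
Qed.

(** * Partners, and sums over the pairs of a matching *)

Lemma wpartnerP S w m : matching S -> (wpartner S w == Some m) = ((m, w) \in S).
Proof.
move=> [_ inj]; rewrite /wpartner; case: pickP => [m' m'S|none]; last by rewrite none.
apply/eqP/idP => [[<-]//|mS]; congr Some; apply/eqP/negPn/negP => nm.
by have := inj _ _ m'S mS; rewrite xpair_eqE eqxx andbT nm => /(_ isT) /andP[_ /eqP[]].
Qed.

Lemma mpartnerP S w m : matching S -> (mpartner S m == Some w) = ((m, w) \in S).
Proof.
move=> [_ inj]; rewrite /mpartner; case: pickP => [w' w'S|none]; last by rewrite none.
apply/eqP/idP => [[<-]//|wS]; congr Some; apply/eqP/negPn/negP => nw.
by have := inj _ _ w'S wS; rewrite xpair_eqE eqxx nw => /(_ isT) /andP[/eqP[]].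
Qed.

Lemma sum_matching S (f : man I * woman I -> nat) : matching S ->
  \sum_(p in S) f p = \sum_w oapp (fun m => f (m, w)) 0 (wpartner S w).
Proof.
move=> matS; rewrite (partition_big snd xpredT) //=; apply: eq_bigr => w _.
case E: (wpartner S w) => [m|] /=.
  rewrite (big_pred1 (m, w)) // => -[m' w'] /=; rewrite xpair_eqE.
  have [->|] := eqVneq w' w; last by rewrite !andbF.
  by rewrite !andbT -wpartnerP // E eq_sym.
rewrite big_pred0 // => -[m w'] /=; apply/negP => /andP[mS /eqP Ew].
by move: mS; rewrite Ew -wpartnerP // E.
Qed.

Lemma sum_matching_le S (f : man I * woman I -> nat) (g : woman I -> nat) :
  matching S -> (forall m w, f (m, w) <= g w) ->
  \sum_(p in S) f p <= \sum_w g w.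
Proof.
move=> matS le_fg; rewrite sum_matching //; apply: leq_sum => w _.
by case: (wpartner S w) => [m|] /=; rewrite ?le_fg.
Qed.

Lemma num_blocking_sum S : num_blocking S = \sum_w #|[set m | blocking S m w]|.
Proof.
rewrite /num_blocking -sum1_card (partition_big snd xpredT) //=.
apply: eq_bigr => w _; rewrite -sum1_card.
rewrite (reindex_onto (fun m => (m, w)) fst) /=; last first.
  by case=> m w' /andP[_ /eqP <-].
by apply: eq_bigl => m; rewrite !inE !eqxx !andbT.
Qed.

Definition covered S : {set woman I} := [set w in wstar I | wpartner S w != None].

Lemma feasibleE S : smc1 I -> feasible S <-> covered S = wstar I.
Proof.
move=> m0; split=> [[fw _]|Ecov].
  apply/setP => w; rewrite !inE andb_idr // => /fw; by case: (wpartner S w).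
split=> [w|m]; first by rewrite -Ecov inE => /andP[_ /eqP].
by rewrite m0 inE.
Qed.

Lemma sum_covered S : matching S -> \sum_(p in S) (p.2 \in wstar I) = #|covered S|.
Proof.
move=> matS; rewrite sum_matching // -sum1_card [RHS]big_mkcond /=.
apply: eq_bigr => w _; rewrite inE; case: (wpartner S w) => [m|] /=.
  by rewrite andbT; case: (w \in _).
by rewrite andbF.
Qed.

(** A partner of [m] is acceptable, hence not listed before his first choice, and equal positions
    would make her that first choice. *)
Lemma first_choice_wants S m w : matching S -> first_choice m w -> (m, w) \notin S ->
  if mpartner S m is Some w' then mprefers m w w' else true.
Proof.
move=> matS fmw; case E: (mpartner S m) => [w'|//]; move/eqP: E; rewrite mpartnerP // => w'S.
have /andP[w'm _] := matS.1 _ w'S; rewrite /= in w'm.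
move=> nS; rewrite /mprefers ltn_neqAle first_choice_le ?(matS.1 _ w'S) // andbT.
apply: contra nS => /eqP Ei; suff -> : w = w' by [].
have /andP[wm _] := first_choice_acceptable fmw.
by rewrite -(nth_index w wm) Ei nth_index.
Qed.

Definition satisfied S : nat := \sum_(p in S) #|wsatisfied p.2 p.1|.

Definition num_first : nat := \sum_w #|[set m | first_choice m w]|.

(** Woman by woman, each first-choice man either blocks with her or is not preferred to her partner;
    if she is unmatched, all of them block. *)
Lemma num_blocking_ge S : matching S -> num_first <= num_blocking S + satisfied S.
Proof.
move=> matS; rewrite num_blocking_sum /satisfied sum_matching // -big_split /=.
apply: leq_sum => w _; set Bw := [set m | _ S m w].
have sub : [set m | first_choice m w] \subset
    Bw :|: odflt set0 (omap (wsatisfied w) (wpartner S w)).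
  apply/subsetP => m; rewrite !inE => fmw; rewrite /blocking first_choice_acceptable //=.
  case E: (wpartner S w) => [m'|] /=.
    rewrite inE fmw leqNgt /wprefers -/(wrank w m) -/(wrank w m').
    case: ltnP => //= lt; rewrite ?orbT // orbF andbT.
    apply: first_choice_wants => //; apply: contraTN lt.
    by rewrite -wpartnerP // E => /eqP[->]; rewrite ltnn.
  rewrite inE orbF andbT; apply: first_choice_wants => //.
  by rewrite -wpartnerP // E.
apply: leq_trans (subset_leq_card sub) _; apply: leq_trans (leq_card_setU _ _) _.
by rewrite leq_add2l; case: (wpartner S w) => //=; rewrite cards0.
Qed.

(** * Maximum-weight matchings when men list at most two women *)

Hypothesis mlist_le2 : forall m, size (mlist m) <= 2.

Section MaxWeight.

Variable S : {set man I * woman I}.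
Hypothesis matS : matching S.
Hypothesis maxS : forall S', matching S' ->
  \sum_(p in S') weight p <= \sum_(p in S) weight p.

(** Exchange argument: a man blocking with a woman other than his first choice must be unmatched,
    and giving him to her would increase the weight. *)
Lemma max_weight_blocking_first m w : blocking S m w -> first_choice m w.
Proof.
case/and3P=> acc mwants wwants; apply/negPn/negP => nfst.
have [w1 fw1] := first_choice_ex acc.
have lt1 : index w1 (mlist m) < index w (mlist m).
  rewrite ltn_neqAle first_choice_le // andbT; apply: contra nfst => /eqP Ei.
  suff -> : w = w1 by [].
  have /andP[w1m _] := first_choice_acceptable fw1; case/andP: acc => wm _.
  by rewrite -(nth_index w wm) -Ei nth_index.
(* A partner would come after [w], which comes after [w1]: three positions in a list of length at
   most two. *)
have free : mpartner S m = None.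
  case E: (mpartner S m) mwants => [w'|//] ; move/eqP: E; rewrite mpartnerP // => w'S.
  have /andP[w'm _] := matS.1 _ w'S; rewrite /= -index_mem in w'm.
  rewrite /mprefers => lt2; exfalso; move: lt1 lt2 w'm (mlist_le2 m).
  by move: (index w1 _) (index w _) (index w' _) (size _) => a b c d; lia.
pose S0 := [set p in S | p.2 != w].
have mwS0 : (m, w) \notin S0 by rewrite !inE eqxx andbF.
have mS w' : (m, w') \notin S by rewrite -mpartnerP // free.
have mat' : matching ((m, w) |: S0).
  case: matS => accS injS; split=> [p|p q].
    by rewrite !inE => /orP[/eqP->//|/andP[/accS]].
  rewrite !inE => /orP[/eqP->|/andP[pS pw]] /orP[/eqP->|/andP[qS qw]].
  - by rewrite eqxx.
  - move=> _ /=; rewrite eq_sym in qw; rewrite qw andbT.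
    by apply: contraNneq (mS q.2) => ->; rewrite -surjective_pairing.
  - move=> _ /=; rewrite pw andbT.
    by apply: contraNneq (mS p.2) => <-; rewrite -surjective_pairing.
  - exact: injS.
have := maxS mat'; rewrite big_setU1 //= leqNgt => /negP; apply.
have -> : \sum_(p in S) weight p =
    \sum_(p in S | p.2 == w) weight p + \sum_(p in S0) weight p.
  rewrite (bigID (fun p => p.2 == w)) /=; congr (_ + _).
  by apply: eq_bigl => p; rewrite !inE.
rewrite ltn_add2r.
have rank_lt : wrank w m < size (wlist w) by rewrite index_mem; case/andP: acc.
case E: (wpartner S w) wwants => [m'|] /= wwants.
  rewrite (big_pred1 (m', w)) => [|[m1 w1'] /=]; last first.
    rewrite xpair_eqE; have [->|] := eqVneq w1' w; last by rewrite !andbF.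
    by rewrite !andbT -wpartnerP // E eq_sym.
  rewrite /wprefers -/(wrank w m) -/(wrank w m') in wwants.
  (* The first digit depends on [w] only, the second does not drop because a better partner
     satisfies more first-choice men, and the last one strictly grows. *)
  rewrite /weight /= -addnS leq_add //; last lia.
  rewrite leq_mul // leq_add2l subset_leq_card //.
  by apply/subsetP => x; rewrite !inE => /andP[-> /=]; lia.
rewrite big_pred0 => [|[m1 w1'] /=]; last first.
  apply/negP => /andP[+ /eqP Ew]; by rewrite Ew -wpartnerP // E.
by rewrite /weight /=; lia.
Qed.

(** The converse of [num_blocking_ge] for maximum weight: the men blocking with a woman and those
    satisfied at her are disjoint sets, and now both consist of first-choice men. *)
Lemma num_blocking_max_weight : num_blocking S + satisfied S <= num_first.
Proof.
rewrite num_blocking_sum /satisfied sum_matching // -big_split /=.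
apply: leq_sum => w _; set Bw := [set m | _ S m w].
case E: (wpartner S w) => [m'|] /=.
  rewrite -cardsUI (_ : Bw :&: wsatisfied w m' = set0) ?cards0 ?addn0.
    apply: subset_leq_card; apply/subsetP => m; rewrite !inE.
    by case/orP=> [/max_weight_blocking_first|/andP[]].
  apply/setP => m; rewrite !inE /blocking E; apply/negP => /andP[/and3P[_ _]].
  by rewrite /wprefers -/(wrank w m) -/(wrank w m') => lt /andP[_]; lia.
rewrite addn0; apply: subset_leq_card; apply/subsetP => m; rewrite !inE.
exact: max_weight_blocking_first.
Qed.

End MaxWeight.

Lemma sum_weight S : \sum_(p in S) weight p =
  K * (K * (\sum_(p in S) (p.2 \in wstar I)) + satisfied S)
  + \sum_(p in S) (size (wlist p.2) - wrank p.2 p.1).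
Proof. by rewrite big_split /= -big_distrr /= big_split /= -big_distrr. Qed.

Lemma max_weight_optimal S :
  smc1 I -> \sum_(w : woman I) size (wlist w) < K -> matching S ->
  (forall S', matching S' -> \sum_(p in S') weight p <= \sum_(p in S) weight p) ->
  (exists S', matching S' /\ feasible S') -> optimal S.
Proof.
move=> m0 K_gt matS maxS [S1 [matS1 feasS1]].
have lt_c S' : matching S' ->
    \sum_(p in S') (size (wlist p.2) - wrank p.2 p.1) < K.
  move=> matS'; apply: leq_ltn_trans K_gt; apply: sum_matching_le => // m w.
  exact: leq_subr.
have lt_b S' : matching S' -> satisfied S' < K.
  move=> matS'; apply: leq_ltn_trans K_gt; apply: sum_matching_le => // m w.
  apply: leq_trans (card_size (wlist w)); apply: subset_leq_card; apply/subsetP => m'.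
  by rewrite inE => /andP[/first_choice_acceptable /andP[]].
(* Comparing first digits, [S] covers as many distinguished women as [S'], hence all of them; then
   the second digits compare. *)
have lex S' : matching S' -> feasible S' ->
    feasible S /\ satisfied S' <= satisfied S.
  move=> matS' feasS'; have := maxS _ matS'; rewrite !sum_weight.
  move=> /lex_leq /(_ (lt_c _ matS)) le1; have le2 := lex_leq le1 (lt_b _ matS).
  rewrite !sum_covered // in le1 le2; move/(feasibleE _ m0): feasS' => Ecov.
  have cov : covered S = wstar I.
    apply/eqP; rewrite eqEcard -{2}Ecov le2 andbT.
    by apply/subsetP => w; rewrite inE => /andP[].
  split; first exact/feasibleE.
  by move: le1; rewrite Ecov cov leq_add2l.
split=> //; first by have [] := lex S1.
move=> S' matS' feasS'; have [_ leb] := lex S' matS' feasS'.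
(* [num_first] lies between [num_blocking S + satisfied S] and [num_blocking S' + satisfied S'], and
   [satisfied S' <= satisfied S]. *)
rewrite -(leq_add2r (satisfied S)); apply: leq_trans (num_blocking_max_weight matS maxS) _.
by apply: leq_trans (num_blocking_ge matS') _; rewrite leq_add2l.
Qed.

End Weights.

(** * The program *)

(** Bounds the growth of the state in a bid. The start value has size five and the inductive
    inequality is strict, whence the four. *)
Lemma esize_best_edge E st : esize (best_edge E st) <= 4 + esize E.
Proof.
rewrite /best_edge; set b0 := (0, 0, 0); set f := (X in foldl X).
suff H b : esize (foldl f b E) < esize b + esize E by have := H b0; rewrite ltnS.
elim: E b => [|e E IH] b; first by rewrite esize_nil addn1.
apply: leq_trans (IH _) _; rewrite esize_cons /f.
by case: ifP => _; lia.
Qed.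

Lemma ptime_gain (X : encType) (st : X -> seq (nat * nat) * seq nat)
    (e : X -> nat * nat * nat) :
  ptime st -> ptime e -> ptime (fun x => gain (st x) (e x)).
Proof.
apply: (@ptime_comp2 _ _ _ _ gain); apply: ptime_if.
- apply: ptime_mem; first by ptime_proj.
  by apply: (ptime_map (f := fun _ (p : nat * nat) => p.2)); ptime_proj.
- exact: ptime_const.
- apply: ptime_subn; first by ptime_proj.
  apply: (ptime_count (f := fun (x : seq (nat * nat) * seq nat * (nat * nat * nat))
                               (m : nat) => m == x.2.1.1)); last by ptime_proj.
  by apply: ptime_eqn; ptime_proj.
Qed.

Lemma ptime_best_edge (X : encType) (E : X -> seq (nat * nat * nat))
    (st : X -> seq (nat * nat) * seq nat) :
  ptime E -> ptime st -> ptime (fun x => best_edge (E x) (st x)).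
Proof.
apply: (@ptime_comp2 _ _ _ _ best_edge).
apply: (ptime_foldl (st := fun (x : seq (nat * nat * nat) * (seq (nat * nat) * seq nat))
    b e => if gain x.2 b < gain x.2 e then e else b)).
- by ptime_proj.
- exact: ptime_const.
- apply: ptime_if; [apply: ptime_leq; [apply: ptime_succ|]; apply: ptime_gain| |];
  by ptime_proj.
- exists (fun n => n); split; first exact: poly_id.
  by move=> x s a; case: ifP => _; lia.
Qed.

Lemma ptime_auction (X : encType) (E : X -> seq (nat * nat * nat)) :
  ptime E -> ptime (fun x => auction (E x)).
Proof.
apply: (@ptime_comp _ _ _ E auction); apply: ptime_fst.
(* A bid adds a pair to the matching and a man to the price list, each no larger than the best
   edge. *)
apply: (ptime_iter (f := bid) (z := fun=> ([::], [::]))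
  (r := fun n => 2 * (n + 10))).
- apply: ptime_sumn; apply: (ptime_map (f := fun _ (e : nat * nat * nat) => e.2));
  by ptime_proj.
- exact: ptime_const.
- have best : ptime (fun x : seq (nat * nat * nat) * (seq (nat * nat) * seq nat) =>
      best_edge x.1 x.2) by apply: ptime_best_edge; ptime_proj.
  apply: ptime_if; last by ptime_proj.
    by apply: ptime_leq; [exact: ptime_const | apply: ptime_gain => //; ptime_proj].
  apply: ptime_pair.
    apply: ptime_cons; first exact: ptime_fst.
    apply: (ptime_filter (f := fun (x : seq (nat * nat * nat) * (seq (nat * nat) * seq nat))
      (p : nat * nat) => p.1 != (best_edge x.1 x.2).1.1)); last by ptime_proj.
    apply: ptime_negb; apply: ptime_eqn; first by ptime_proj.
    by do 2![apply: ptime_fst]; apply: ptime_best_edge; ptime_proj.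
  by apply: ptime_cons; [do 2![apply: ptime_fst] | ptime_proj].
- by do !constructor.
- move=> E' [A H]; rewrite /bid; case: ifP => _; last by rewrite leq_addr.
  rewrite esize_pair /= !esize_cons.
  have := esize_best_edge E' (A, H); have := esize_filter
    (fun p : nat * nat => p.1 != (best_edge E' (A, H)).1.1) A.
  rewrite !esize_pair /=; lia.
Qed.

(* An instance is given by the lists of the men, the lists of the women, and the
   two lists of distinguished persons. *)
Notation smc_data := (seq (seq nat) * (seq (seq nat) * (seq nat * seq nat)))%type.

Definition smc_first (D : smc_data) (m w : nat) : bool :=
  let l := [seq w' <- nth [::] D.1 m | m \in nth [::] D.2.1 w'] in
  (w \in l) && (index w l == 0).

(** One more than the total length of the women's lists, which bounds both lower digits and the size
    of any matching. *)
Definition smc_base (D : smc_data) : nat := (size (flatten D.2.1)).+1.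

(* [smc_base D] times the weight: the factor makes the additive error of the
   auction irrelevant. *)
Definition smc_weight (D : smc_data) (p : nat * nat) : nat :=
  smc_base D * (smc_base D *
    (smc_base D * (if p.2 \in D.2.2.2 then 1 else 0)
     + count (fun m => smc_first D m p.2 &&
                (index p.1 (nth [::] D.2.1 p.2) <= index m (nth [::] D.2.1 p.2)))
         (nth [::] D.2.1 p.2))
    + (size (nth [::] D.2.1 p.2) - index p.1 (nth [::] D.2.1 p.2))).

(** Women are read off the men's lists, so a pair is repeated when several men list its woman;
    [auctionP] allows this. *)
Definition smc_pairs (D : smc_data) : seq (nat * nat) :=
  flatten [seq [seq (m, w) | m <- [seq m <- nth [::] D.2.1 w | w \in nth [::] D.1 m]]
          | w <- flatten D.1].

Definition smc_matching (D : smc_data) : seq (nat * nat) :=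
  auction [seq (p, smc_weight D p) | p <- smc_pairs D].

Definition smc_solve (D : smc_data) : tree :=
  if all (fun w => w \in [seq p.2 | p <- smc_matching D]) D.2.2.2
  then Cons Nil (enc (smc_matching D)) else Nil.

Lemma ptime_smc_first (X : encType) (D : X -> smc_data) (m w : X -> nat) :
  ptime D -> ptime m -> ptime w -> ptime (fun x => smc_first (D x) (m x) (w x)).
Proof.
move=> HD Hm Hw.
have Hl : ptime (fun x => [seq w' <- nth [::] (D x).1 (m x) | m x \in nth [::] (D x).2.1 w']).
  apply: (ptime_filter (f := fun x (w' : nat) => m x \in nth [::] (D x).2.1 w')).
    apply: ptime_mem; first by apply: (ptime_comp Hm); ptime_proj.
    apply: ptime_nth; first by ptime_proj.
    do 2![apply: ptime_fst || apply: ptime_snd]; by apply: (ptime_comp HD); ptime_proj.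
  by apply: ptime_nth => //; exact: ptime_fst.
apply: ptime_andb; first exact: ptime_mem.
by apply: ptime_eqn; [exact: ptime_index | exact: ptime_const].
Qed.

Lemma ptime_smc_weight : ptime2 smc_weight.
Proof.
have HK : ptime (fun x : smc_data * (nat * nat) => smc_base x.1).
  by apply: ptime_succ; apply: ptime_size; apply: ptime_flatten; ptime_proj.
have Hl : ptime (fun x : smc_data * (nat * nat) => nth [::] x.1.2.1 x.2.2).
  by apply: ptime_nth; ptime_proj.
have Hi : ptime (fun x : smc_data * (nat * nat) => index x.2.1 (nth [::] x.1.2.1 x.2.2)).
  by apply: ptime_index => //; ptime_proj.
apply: ptime_muln => //; apply: ptime_addn; last by apply: ptime_subn => //; exact: ptime_size.
apply: ptime_muln => //; apply: ptime_addn.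
  apply: ptime_muln => //; apply: ptime_if; try exact: ptime_const.
  by apply: ptime_mem; ptime_proj.
apply: (ptime_count (f := fun (x : smc_data * (nat * nat)) (m : nat) => smc_first x.1 m x.2.2 &&
  (index x.2.1 (nth [::] x.1.2.1 x.2.2) <= index m (nth [::] x.1.2.1 x.2.2)))) => //.
apply: ptime_andb; first by apply: ptime_smc_first; ptime_proj.
apply: ptime_leq; first by apply: (ptime_comp Hi); ptime_proj.
apply: ptime_index; first by ptime_proj.
by apply: (ptime_comp Hl); ptime_proj.
Qed.

Lemma ptime_smc_pairs : ptime smc_pairs.
Proof.
apply: ptime_flatten.
apply: (ptime_map (f := fun (D : smc_data) (w : nat) =>
   [seq (m, w) | m <- [seq m <- nth [::] D.2.1 w | w \in nth [::] D.1 m]])); last first.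
  by apply: ptime_flatten; ptime_proj.
apply: (ptime_map (f := fun (x : smc_data * nat) (m : nat) => (m, x.2))).
  by ptime_proj.
apply: (ptime_filter (f := fun (x : smc_data * nat) (m : nat) => x.2 \in nth [::] x.1.1 m)).
  by apply: ptime_mem; [|apply: ptime_nth]; ptime_proj.
by apply: ptime_nth; ptime_proj.
Qed.

Lemma ptime_smc_matching : ptime smc_matching.
Proof.
apply: ptime_auction.
apply: (ptime_map (f := fun D p => (p, smc_weight D p))); last exact: ptime_smc_pairs.
apply: ptime_pair; first by ptime_proj.
exact: ptime_smc_weight.
Qed.

Lemma ptime_smc_solve : ptime smc_solve.
Proof.
apply: ptime_if; last exact: ptime_const.
- apply: (ptime_all (f := fun (D : smc_data) (w : nat) =>
    w \in [seq p.2 | p <- smc_matching D])); last by ptime_proj.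
  apply: ptime_mem; first by ptime_proj.
  apply: (ptime_map (f := fun _ (p : nat * nat) => p.2)); first by ptime_proj.
  by apply: (ptime_comp ptime_smc_matching); ptime_proj.
- apply: (@ptime_comp _ _ _ smc_matching (fun A => Cons Nil (enc A) : tree)); last first.
    exact: ptime_smc_matching.
  apply: (@ptime_expr _ _ _ (ECons ENil (EVar 0)) _ (poly_add poly_id (poly_const 2))).
    by move=> x s /= ->.
  by move=> x; rewrite /esize /=; lia.
Qed.

(** * Correctness *)

Lemma uniq_map_inj_in (T1 T2 : eqType) (f : T1 -> T2) s :
  uniq (map f s) -> {in s &, injective f}.
Proof.
elim: s => //= x s IH /andP[xs us] y z; rewrite !inE.
case/orP=> [/eqP->|ys] /orP[/eqP->|zs] Ef //.
- by rewrite Ef map_f in xs.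
- by rewrite -Ef map_f in xs.
- exact: IH.
Qed.

Section Correctness.

Variable I : smc.
Implicit Types (m : man I) (w : woman I) (p : man I * woman I).

Definition smc_input : smc_data :=
  ([seq [seq val w | w <- mlist m] | m <- enum (man I)],
   ([seq [seq val m | m <- wlist w] | w <- enum (woman I)],
    ([seq val m | m <- enum (mstar I)], [seq val w | w <- enum (wstar I)]))).

Lemma enc_seq_map (A B : Type) (f : A -> B) (g : B -> tree) s :
  enc_seq g [seq f x | x <- s] = enc_seq (fun x => g (f x)) s.
Proof. by elim: s => //= x s ->. Qed.

Lemma eq_enc_seq (A : Type) (f g : A -> tree) s : f =1 g -> enc_seq f s = enc_seq g s.
Proof. by move=> fg; elim: s => //= x s ->; rewrite fg. Qed.

Lemma enc_smc_input : enc smc_input = enc_smc I.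
Proof.
rewrite /enc /= /enc_smc !enc_seq_map.
by congr Cons; [|congr Cons]; apply: eq_enc_seq => x; rewrite enc_seq_map.
Qed.

Lemma nth_mlist m : nth [::] smc_input.1 m = [seq val w | w <- mlist m].
Proof. by rewrite (nth_map m) ?size_enum_ord // nth_ord_enum. Qed.

Lemma nth_wlist w : nth [::] smc_input.2.1 w = [seq val m | m <- wlist w].
Proof. by rewrite (nth_map w) ?size_enum_ord // nth_ord_enum. Qed.

Definition pair_val p : nat * nat := (val p.1, val p.2).

Lemma pair_val_inj : injective pair_val.
Proof. by move=> [m w] [m' w'] [/val_inj -> /val_inj ->]. Qed.

Lemma smc_firstE m w : smc_first smc_input m w = first_choice m w.
Proof.
rewrite /smc_first /first_choice nth_mlist filter_map.
rewrite (@eq_filter _ _ (fun w' => m \in wlist w')); last first.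
  by move=> w' /=; rewrite nth_wlist mem_map //; exact: val_inj.
by rewrite mem_map ?index_map //; exact: val_inj.
Qed.

Lemma smc_pairsP (q : nat * nat) :
  reflect (exists2 p, q = pair_val p & acceptable p.1 p.2) (q \in smc_pairs smc_input).
Proof.
apply: (iffP flatten_mapP) => [[w _ /mapP[m]]|[[m w] -> /andP[/= wm mw]]].
  rewrite mem_filter => /andP[wm mw] ->.
  (* An index out of range makes [nth] return the empty list, which contradicts membership; so both
     indices denote persons. *)
  have [wn|wn] := ltnP w (nwomen I); last first.
    by move: mw; rewrite [nth _ _ w]nth_default // size_map size_enum_ord.
  have [mn|mn] := ltnP m (nmen I); last first.
    by move: wm; rewrite [nth _ _ m]nth_default // size_map size_enum_ord.
  exists (Ordinal mn, Ordinal wn) => //; apply/andP; split.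
    by move: wm; rewrite (nth_mlist (Ordinal mn)) => /mapP[w' ? /(@val_inj _ _ _ (Ordinal wn)) ->].
  by move: mw; rewrite (nth_wlist (Ordinal wn)) => /mapP[m' ? /(@val_inj _ _ _ (Ordinal mn)) ->].
exists (val w).
  apply/flatten_mapP; exists m; first by rewrite mem_enum.
  exact: map_f.
by apply: map_f; rewrite mem_filter nth_mlist nth_wlist !map_f.
Qed.

Lemma smc_weightE p :
  smc_weight smc_input (pair_val p) = smc_base smc_input * weight (smc_base smc_input) p.
Proof.
case: p => m w; rewrite /smc_weight /weight /= -/smc_input.
set l := nth _ _ _; have -> : l = [seq val m | m <- wlist w] by rewrite -nth_wlist.
rewrite size_map index_map; last exact: val_inj.
rewrite mem_map; last exact: val_inj.
rewrite mem_enum (_ : (if _ then 1 else 0) = (w \in wstar I)) //.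
congr (_ * (_ * (_ + _) + _)).
(* Counting along the list of [w] misses nobody: she accepts all her first-choice men. *)
rewrite count_map -size_filter; set s := filter _ _.
rewrite -(card_uniqP _); last exact: filter_uniq (wlist_uniq w).
apply: eq_card => m'; rewrite mem_filter [RHS]inE /= smc_firstE index_map; last exact: val_inj.
rewrite -andbA; case fm: (first_choice m' w) => //=.
by have /andP[_ ->] := first_choice_acceptable fm; rewrite andbT.
Qed.

Lemma smc_base_gt : \sum_(w : woman I) size (wlist w) < smc_base smc_input.
Proof.
rewrite ltnS size_flatten sumnE /shape -map_comp big_map big_enum /=.
by apply: eq_leq; apply: eq_bigr => w _; rewrite size_map.
Qed.

Lemma seq_pair_val (s : seq (nat * nat)) : {subset s <= smc_pairs smc_input} ->
  exists s', s = [seq pair_val p | p <- s'].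
Proof.
elim: s => [|q s IH] sub; first by exists [::].
have [p -> _] := smc_pairsP _ (sub q (mem_head _ _)).
have [|s' ->] := IH; first by move=> x xs; apply: sub; rewrite inE xs orbT.
by exists (p :: s').
Qed.

Lemma smc_solve_correct :
  smc1 I -> (forall m, size (mlist m) <= 2) -> smc_answer I (smc_solve smc_input).
Proof.
move=> m0 le2; rewrite /smc_solve /smc_matching.
have [] := auctionP (smc_pairs smc_input) (smc_weight smc_input).
set A := auction _ => uA1 uA2 AP maxA.
have [s As] := seq_pair_val AP.
have us : uniq s by apply: (@map_uniq _ _ (fun p => (pair_val p).1)); rewrite map_comp -As.
have matS : matching [set p in s].
  split=> [p|p q]; rewrite !inE.
    move=> ps; have /AP /smc_pairsP[p' /pair_val_inj <- //] : pair_val p \in A.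
    by rewrite As map_f.
  move=> ps qs npq; apply/andP; split; apply: contraNneq npq => Epq; apply/eqP.
    by move: uA1; rewrite As -map_comp => /uniq_map_inj_in; apply; rewrite //= Epq.
  by move: uA2; rewrite As -map_comp => /uniq_map_inj_in; apply; rewrite //= Epq.
have sumE (S : {set man I * woman I}) t : uniq t -> S =i t ->
    \sum_(q <- [seq pair_val p | p <- t]) smc_weight smc_input q =
    smc_base smc_input * \sum_(p in S) weight (smc_base smc_input) p.
  move=> ut St; rewrite big_map big_distrr /= (eq_bigl _ _ St).
  by rewrite -big_uniq //; apply: eq_bigr => p _; rewrite smc_weightE.
have maxS (S' : {set man I * woman I}) : matching S' ->
    \sum_(p in S') weight (smc_base smc_input) p <=
    \sum_(p in [set p in s]) weight (smc_base smc_input) p.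
  move=> matS'; have [accS' injS'] := matS'.
  have inj (f : man I * woman I -> nat) :
      (forall p q, p \in S' -> q \in S' -> p != q -> f p != f q) ->
      uniq [seq f p | p <- enum S'].
    move=> inj_f; rewrite map_inj_in_uniq ?enum_uniq // => p q; rewrite !mem_enum => pS qS.
    by move/eqP; apply: contraTeq; exact: inj_f.
  have := maxA [seq pair_val p | p <- enum S'].
  rewrite -!map_comp /= (sumE S') ?enum_uniq //; last by move=> p; rewrite mem_enum.
  rewrite As (sumE [set p in s]) //; last by move=> p; rewrite inE.
  rewrite size_map -cardE => H.
  (* All auction weights are multiples of the base, and the auction's error [#|S'|] is below it, so
     the maximum is exact. *)
  apply: (lex_leq (K := smc_base smc_input) (c := 0) (d := #|S'|)).
    rewrite addn0; apply: H.
    - by apply: inj => p q pS qS npq; have /andP[] := injS' p q pS qS npq.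
    - by apply: inj => p q pS qS npq; have /andP[] := injS' p q pS qS npq.
    - by move=> q /mapP[p]; rewrite mem_enum => pS' ->; apply/smc_pairsP; exists p; rewrite ?accS'.
  apply: leq_ltn_trans smc_base_gt; rewrite -sum1_card.
  (* Writing each 1 as a membership bounds it by the length of the woman's list, also for women
     whose list is empty. *)
  rewrite (eq_bigr (fun p => (p.1 \in wlist p.2) : nat)); last first.
    by move=> p /accS' /andP[_ ->].
  apply: sum_matching_le => // m w /=; rewrite -has_pred1 has_count.
  by apply: leq_trans (count_size (pred1 m) _); case: (count _ _).
have coverE w : (val w \in [seq q.2 | q <- A]) = (wpartner [set p in s] w != None).
  rewrite As -map_comp; apply/mapP/idP => [[[m w'] ps /= /val_inj Ew]|].
    by rewrite /wpartner; case: pickP => // /(_ m); rewrite inE Ew ps.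
  rewrite /wpartner; case: pickP => // m; rewrite inE => mws _.
  by exists (m, w).
have feasE : all (fun v => v \in [seq q.2 | q <- A]) smc_input.2.2.2 <-> feasible [set p in s].
  rewrite all_map; split=> [/allP H | [H _]].
    split=> [w ws|m]; last by rewrite m0 inE.
    by apply/eqP; rewrite -coverE; apply: H; rewrite mem_enum.
  by apply/allP => w; rewrite mem_enum /= coverE => /H /eqP.
have optS := max_weight_optimal le2 m0 smc_base_gt matS maxS.
case: ifPn => [/feasE feasS | nfeas].
  right; exists s; split=> //; last by apply: optS; exists [set p in s].
  congr Cons; rewrite As /enc /= enc_seq_map.
  exact: eq_enc_seq.
(* Any feasible matching would make the computed one optimal, hence feasible, against the failed
   test. *)
left; split=> // -[S' S'P]; have [_ feasS _] := optS (ex_intro _ S' S'P).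
by move: nfeas; rewrite feasE.2.
Qed.

End Correctness.

Theorem theorem8 :
  poly_time_solvable
    (fun I : smc => smc1 I /\ forall m : man I, size (mlist m) <= 2)
    enc_smc smc_answer.
Proof.
have [p [n [q [Pq Hp]]]] := ptime_smc_solve.
have [c [k Hq]] := poly_bound Pq.
exists p, c, k => I [m0 le2].
have [|t [s [ex s0 _ tq _]]] := Hp (smc_input I) (update (fun=> Nil) 0 (enc_smc I)).
  by rewrite updateE enc_smc_input.
exists t, (s 0); split; first by exists s.
  by rewrite -enc_smc_input; exact: leq_trans tq (Hq _).
by rewrite s0; exact: smc_solve_correct.
Qed.
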